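(* Let $R$ be a commutative ring and let $n$ be a positive integer. Then $R$ is nil-clean if and only if $M_n(R)$ is nil-clean.
   Context: All rings are associative with an identity. An element $a$ of a ring $S$ is nil-clean if there is an idempotent $e\in S$ such that $a-e$ is nilpotent; the ring $S$ is nil-clean if every element of $S$ is nil-clean. $M_n(R)$ is the ring of all $n\times n$ matrices over $R$. *)

(* Defs.v *)
From mathcomp Require Import all_boot all_algebra.

Set Implicit Arguments.
Unset Strict Implicit.
Unset Printing Implicit Defensive.

Import GRing.Theory.
Local Open Scope ring_scope.

(* Rings are [pzRingType]s: associative and unital, the zero ring included. *)

Definition idempotent_elt (S : pzRingType) (e : S) : Prop := e * e = e.

Definition nilpotent_elt (S : pzRingType) (x : S) : Prop :=
  exists k : nat, x ^+ k = 0.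

Definition nil_clean_elt (S : pzRingType) (a : S) : Prop :=
  exists e : S, idempotent_elt e /\ nilpotent_elt (a - e).

Definition nil_clean (S : pzRingType) : Prop :=
  forall a : S, nil_clean_elt a.

(* Main.v *)
(* If [R] is nil-clean and commutative, then 2 = 2^2 - 2 is nilpotent and, up to
   nilpotent entries, which do not matter, every matrix has idempotent entries.
   Splitting [R] along these idempotents reduces to 0-1 matrices, and working
   modulo the nilpotent 2 reduces these to matrices over F_2.  There, a cyclic
   invariant subspace makes the matrix block triangular with a companion block,
   for which an explicit idempotent is given.  Conversely, a decomposition of
   the scalar matrix [a] commutes, so that [a^2 - a] is nilpotent and [a] lifts
   to an idempotent. *)
Require Import Defs.
From mathcomp Require Import all_boot all_algebra.

Set Implicit Arguments.
Unset Strict Implicit.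
Unset Printing Implicit Defensive.

Import GRing.Theory.
Local Open Scope ring_scope.

(** * Working modulo a central nilpotent element and along a central idempotent *)

Section CentralNilpotent.
Variable S : pzRingType.
Implicit Types a c e x y z : S.

Lemma exprD_mod c x y m : (forall s, GRing.comm c s) ->
  exists z, (x + c * y) ^+ m = x ^+ m + c * z.
Proof.
move=> cC; elim: m => [|m [z IHm]].
  by exists 0; rewrite !expr0 mulr0 addr0.
exists (x * z + y * (x ^+ m + c * z)).
by rewrite exprS IHm mulrDl [x * (_ + _)]mulrDr -exprS [x * (c * z)]mulrA
  -(cC x) -!mulrA [c * (_ + _)]mulrDr addrA.
Qed.

Lemma nilpotent_mod c x z m : (forall s, GRing.comm c s) ->
  nilpotent_elt c -> x ^+ m = c * z -> nilpotent_elt x.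
Proof.
move=> cC [k ck0] xm; exists (m * k)%N.
by rewrite exprM xm exprMn_comm // ck0 mul0r.
Qed.

Lemma nilpotent_addMl c x y : (forall s, GRing.comm c s) ->
  nilpotent_elt c -> nilpotent_elt x -> nilpotent_elt (x + c * y).
Proof.
move=> cC cnil [m xm0]; have [z] := exprD_mod x y m cC.
by rewrite xm0 add0r; apply: nilpotent_mod.
Qed.

(* One step [x |-> 3x^2 - 2x^3] of Newton's iteration for [x^2 - x] squares the
   error term [x^2 - x], up to a factor. *)
Lemma idempotent_lift x : nilpotent_elt (x * x - x) ->
  exists y, idempotent_elt (x + (x * x - x) * y).
Proof.
(* The exponent is raised to a power of two, so that each squaring of the error lowers [k] by
   one. *)
case=> k hk; have {hk} : (x * x - x) ^+ (2 ^ k) = 0.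
  by rewrite -(subnK (ltnW (ltn_expl k (ltnSn 1)))) exprD hk mulr0.
elim: k x => [|k IHk] x.
  by rewrite expr1 => /subr0_eq xx; exists 0; rewrite mulr0 addr0.
(* With [t = 2x - 1], the Newton step is [x - h * t], and [t * t = 4h + 1]. *)
set h := x * x - x => hk; pose t := x *+ 2 - 1.
have hx : h * x = x * h by rewrite mulrBl mulrBr mulrA.
have ht : GRing.comm h t.
  by apply: commrB; [apply: commrMn | apply: commr1].
have tt : t * t = h *+ 4 + 1.
  apply/eqP; rewrite -subr_eq -expr2 subr_sqr_1 -addrA -opprD addrNK.
  rewrite -[1 + 1]/(1 *+ 2) -mulrnBl.
  by rewrite mulrnAl mulrnAr -mulrnA mulrBl mul1r.
have mult u : u * t = u * x *+ 2 - u by rewrite /t mulrBr mulr1 mulrnAr.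
have xt : x * t = t * x by rewrite mult /t mulrBl mulrnAl mul1r.
clearbody t.
have x1E : (x - h * t) * (x - h * t) - (x - h * t) = h * h * (t * t - 4%:R).
  transitivity (h - h * t * t + h * t * (h * t)).
    have xu : x * (h * t) = h * t * x by rewrite mulrA -hx -!mulrA xt.
    rewrite (mult (h * t)) mulr2n mulrBl !mulrBr xu /h.
    by rewrite !(opprD, opprK) !addrA [LHS](ACl (1*5*2*3*6*4)).
  have -> : h * t * (h * t) = h * h * (t * t).
    by rewrite -!mulrA (mulrA t) -ht !mulrA.
  rewrite [RHS]mulrBr -[h * t * t]mulrA tt [h * (_ + 1)]mulrDr mulr1.
  by rewrite opprD addrCA subrr addr0 addrC mulr_natr mulrnAr.
have [|y yP] := IHk (x - h * t).
  rewrite x1E exprMn_comm; last first.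
    apply: commrB; first by apply/commrM; apply/commr_sym/commrM.
    exact/commrMn/commr1.
  by rewrite -expr2 -exprM -expnS hk mul0r.
exists (h * (t * t - 4%:R) * y - t); rewrite mulrBr addrCA addrC.
by move: yP; rewrite x1E !mulrA.
Qed.

(** The idempotent lifting [x] differs from it by a multiple of [c], so [a] minus this idempotent is
    still nilpotent modulo [c]. *)
Lemma nil_clean_mod c a x z w k : (forall s, GRing.comm c s) ->
  nilpotent_elt c -> x * x - x = c * z -> (a - x) ^+ k = c * w ->
  nil_clean_elt a.
Proof.
move=> cC cnil xz axw; have [|y ey] := @idempotent_lift x.
  by apply: (@nilpotent_mod c _ z 1); rewrite ?expr1.
exists (x + (x * x - x) * y); split=> //.
rewrite xz -mulrA opprD addrA -mulrN; apply: nilpotent_addMl => //.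
exact: nilpotent_mod axw.
Qed.

(** The central idempotent splits the ring as a product, in which products and powers are computed
    componentwise. *)
Lemma nil_clean_glue e a b : (forall s, GRing.comm e s) -> e * e = e ->
  nil_clean_elt a -> nil_clean_elt b -> nil_clean_elt (e * a + (1 - e) * b).
Proof.
move=> eC ee [f [ff [k fk]]] [g [gg [l gl]]].
pose glue u v := e * u + (1 - e) * v.
have fC s : GRing.comm (1 - e) s.
  by apply: commr_sym; apply: commrB; [apply: commr1 | apply: commr_sym].
have efe : e * (1 - e) = 0 by rewrite mulrBr mulr1 ee subrr.
have fe : (1 - e) * e = 0 by rewrite mulrBl mul1r ee subrr.
have f2 : (1 - e) * (1 - e) = 1 - e by rewrite mulrBr mulr1 fe subr0.
have glueM u v u' v' : glue u v * glue u' v' = glue (u * u') (v * v').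
  have sw c d s s' : (forall s, GRing.comm d s) ->
      c * s * (d * s') = c * d * (s * s').
    by move=> dC; rewrite -!mulrA (mulrA s) -dC !mulrA.
  rewrite /glue mulrDl !mulrDr (sw e e) // (sw e (1 - e)) //.
  rewrite (sw (1 - e) e) // (sw (1 - e) (1 - e)) // ee efe fe f2.
  by rewrite !mul0r addr0 add0r.
have glueX u v m : glue u v ^+ m = glue (u ^+ m) (v ^+ m).
  elim: m => [|m IHm]; first by rewrite !expr0 /glue !mulr1 subrKC.
  by rewrite !exprS IHm glueM.
exists (glue f g); split; first by rewrite /idempotent_elt glueM ff gg.
exists (k + l)%N.
have -> : e * a + (1 - e) * b - glue f g = glue (a - f) (b - g).
  by rewrite /glue !mulrBr opprD addrACA.
by rewrite glueX !exprD fk gl mul0r mulr0 /glue !mulr0 addr0.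
Qed.

End CentralNilpotent.

(** * Matrices modulo nilpotent entries and modulo 2 *)

Section MatrixLift.
Variables (R : comPzRingType) (n : nat).
Implicit Types A B X : 'M[R]_n.

Lemma nilpotent_scalar_mx (a : R) :
  nilpotent_elt a -> nilpotent_elt (a%:M : 'M[R]_n).
Proof. by case=> k ak; exists k; rewrite -rmorphXn /= ak raddf0. Qed.

(** Entries of [B] are added one at a time, each as a central nilpotent scalar matrix times a matrix
    unit. *)
Lemma nilpotent_addmx X B : nilpotent_elt X ->
  (forall i j, nilpotent_elt (B i j)) -> nilpotent_elt (X + B).
Proof.
move=> Xnil Bnil; rewrite [B]matrix_sum_delta pair_big /=.
elim: (index_enum _) X Xnil => [|p r IHr] X Xnil.
  by rewrite big_nil addr0.
rewrite big_cons addrA; apply: IHr; rewrite -mul_scalar_mx mulmxE.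
apply: nilpotent_addMl => //; first by move=> A; exact: comm_scalar_mx.
exact: nilpotent_scalar_mx.
Qed.

Lemma nil_clean_addmx A B : nil_clean_elt A ->
  (forall i j, nilpotent_elt (B i j)) -> nil_clean_elt (A + B).
Proof.
move=> [E [EE AE]] Bnil; exists E; split=> //.
by rewrite addrAC; apply: nilpotent_addmx.
Qed.

(** Integer matrices link the two rings: an identity over F_2 holds over the integers modulo 2, and
    2 is nilpotent in [R]. *)
Lemma nil_clean_map_intmx (A : 'M[int]_n) : nilpotent_elt (2%:R : R) ->
  nil_clean_elt (map_mx intr A : 'M['F_2]_n) ->
  nil_clean_elt (map_mx intr A : 'M[R]_n).
Proof.
move=> nil2 [E [EE [k AEk]]].
pose E' : 'M[int]_n := map_mx (fun x : 'F_2 => (x : nat)%:Z) E.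
have E'E : map_mx intr E' = E.
  by apply/matrixP=> i j; rewrite !mxE; apply: natr_Zp.
have mod2 (M : 'M[int]_n) : map_mx intr M = 0 :> 'M['F_2]_n ->
    exists M', map_mx intr M = (2%:R : R)%:M * map_mx intr M' :> 'M[R]_n.
  move=> M0; exists (map_mx (fun z => z %/ 2)%Z M); apply/matrixP=> i j.
  rewrite -mulmxE mul_scalar_mx !mxE -[2%:R]/(2%:~R) -intrM; congr intr.
  have /matrixP/(_ i j) := M0; rewrite !mxE => /eqP.
  by rewrite -(@dvdz_pcharf 'F_2 2 (pchar_Fp _)) // mulrC => /divzK.
have mapX (S : comPzRingType) (M : 'M[int]_n) m :
    map_mx intr (M ^+ m) = (map_mx intr M) ^+ m :> 'M[S]_n.
  elim: m => [|m IHm]; first by rewrite !expr0 map_mx1.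
  by rewrite !exprS -!mulmxE map_mxM IHm.
have [|Z ZP] := mod2 (E' *m E' - E').
  by rewrite map_mxB map_mxM E'E mulmxE EE subrr.
have [|W WP] := mod2 ((A - E') ^+ k).
  by rewrite mapX map_mxB E'E.
apply: (@nil_clean_mod _ (2%:R)%:M _ (map_mx intr E')
  (map_mx intr Z) (map_mx intr W) k).
- by move=> B; apply: comm_scalar_mx.
- exact: nilpotent_scalar_mx.
- by rewrite -ZP map_mxB map_mxM.
- by rewrite -WP mapX map_mxB.
Qed.

End MatrixLift.

(** * Similarity and block triangular matrices over a field *)

Section BlockTriangular.
Variable F : fieldType.

(** [P] and [Q] are rectangular in type, since a size such as [d + \rank U^C] equals [n] only
    propositionally. *)
Lemma nil_clean_similar m n (P : 'M[F]_(m, n)) (Q : 'M[F]_(n, m)) A :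
  P *m Q = 1%:M -> Q *m P = 1%:M ->
  nil_clean_elt (P *m A *m Q) -> nil_clean_elt A.
Proof.
move=> PQ QP [E [EE [k Ek]]]; exists (Q *m E *m P); split.
  rewrite /idempotent_elt -mulmxE -!mulmxA (mulmxA P) PQ mul1mx.
  by rewrite (mulmxA E) [E *m E]EE.
exists k.
have AE : A - Q *m E *m P = Q *m (P *m A *m Q - E) *m P.
  by rewrite mulmxBr mulmxBl !mulmxA QP mul1mx -(mulmxA A) QP mulmx1.
suff XQ X : (Q *m X *m P) ^+ k = Q *m (X ^+ k) *m P.
  by rewrite AE XQ Ek mulmx0 mul0mx.
elim: k {Ek} => [|k IHk]; first by rewrite !expr0 mulmx1 QP.
rewrite !exprS IHk -!mulmxE -!mulmxA; do 2!congr (_ *m _).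
by rewrite mulmxA PQ mul1mx.
Qed.

Lemma nil_clean_block d1 d2 (C : 'M[F]_d1) (B : 'M[F]_(d2, d1)) (D : 'M[F]_d2) :
  nil_clean_elt C -> nil_clean_elt D -> nil_clean_elt (block_mx C 0 B D).
Proof.
move=> [E [EE [k Ek]]] [G [GG [l Gl]]]; exists (block_mx E 0 0 G); split.
  rewrite /idempotent_elt -mulmxE mulmx_block !mulmx0 !mul0mx !addr0 add0r.
  by rewrite [E *m E]EE [G *m G]GG.
rewrite opp_block_mx add_block_mx !subr0.
have blockX X Y m : exists Z,
    block_mx X 0 B Y ^+ m = block_mx (X ^+ m) 0 Z (Y ^+ m).
  elim: m => [|m [Z IHm]].
    by exists 0; rewrite !expr0; apply: scalar_mx_block.
  exists (B *m X ^+ m + Y *m Z).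
  by rewrite !exprS IHm -!mulmxE mulmx_block !mulmx0 !mul0mx !addr0 add0r.
have [Z ZP] := blockX (C - E) (D - G) (k + l)%N.
(* The power [k + l] has zero diagonal blocks, so its square vanishes. *)
exists ((k + l) * 2)%N; rewrite exprM ZP !exprD Ek Gl mul0r mulr0 expr2.
rewrite -mulmxE mulmx_block !mulmx0 !mul0mx !addr0.
by rewrite -block_mx0.
Qed.

(** Completing the rows of [U] by a basis of a complement gives a basis in which [A] is block
    triangular with corner [C]. *)
Lemma nil_clean_invariant d n (U : 'M[F]_(d, n)) (C : 'M[F]_d) (A : 'M[F]_n) :
  row_free U -> U *m A = C *m U -> nil_clean_elt C ->
  (forall D : 'M[F]_(n - d), nil_clean_elt D) -> nil_clean_elt A.
Proof.
move=> Ufree UA Cnc Dnc.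
have rU : \rank U = d by apply/eqP.
pose P := col_mx U (row_base U^C%MS).
have Pfull : row_full P.
  rewrite /P -[row_full _]/(\rank _ == n) -addsmxE.
  by rewrite (adds_eqmx (eqmx_refl _) (eq_row_base _));
     apply: addsmx_compl_full.
have Pfree : row_free P.
  move: Pfull; rewrite /row_full /row_free => /eqP->.
  by rewrite mxrank_compl rU subnKC // -rU rank_leq_col.
apply: (@nil_clean_similar _ _ P (pinvmx P)).
- exact: mulmxVp.
- exact: mulVpmx.
pose BD := row_base U^C%MS *m A *m pinvmx P.
have -> : P *m A *m pinvmx P = block_mx C 0 (lsubmx BD) (rsubmx BD).
  have UP : U *m pinvmx P = row_mx 1%:M 0.
    have : P *m pinvmx P = 1%:M by apply: mulmxVp.
    by rewrite mul_col_mx scalar_mx_block block_mxEv => /eq_col_mx[].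
  rewrite mul_col_mx mul_col_mx block_mxEv UA -mulmxA UP.
  by rewrite mul_mx_row mulmx1 mulmx0 hsubmxK.
apply: nil_clean_block => //.
have: (\rank U^C = n - d)%N by rewrite mxrank_compl rU.
by move: (\rank _) (rsubmx _) => r M rE; move: M; rewrite rE.
Qed.

End BlockTriangular.

(** * Companion matrices over F_2 *)

Lemma F2_addrr (V : lmodType 'F_2) (u : V) : u + u = 0.
Proof.
by rewrite -[u]scale1r -scalerDl (_ : 1 + 1 = 0) ?scale0r //; apply/eqP.
Qed.

Lemma F2_neq0 (x : 'F_2) : x != 0 -> x = 1.
Proof. by rewrite -val_eqE => x0; apply/val_inj; case: x x0 => -[|[|]]. Qed.

Section Companion.
Variables (d : nat) (c : 'rV['F_2]_d.+1).

(** Standard basis indexed by [nat]; [v i] is zero for [i > d]. *)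
Let v (i : nat) : 'rV['F_2]_d.+1 := \row_k (k == i :> nat)%:R.

Let rows (f : nat -> 'rV['F_2]_d.+1) : 'M['F_2]_d.+1 := \matrix_(i < d.+1) f i.

Let mul_v_rows f i : (i <= d)%N -> v i *m rows f = f i.
Proof.
rewrite -ltnS => lt_i.
rewrite -[RHS](rowK (fun k : 'I_d.+1 => f k) (Ordinal lt_i)).
rewrite rowE; congr (_ *m _); apply/rowP=> k; rewrite !mxE eqxx.
by rewrite -val_eqE.
Qed.

Let rows_eq0 (M : 'M['F_2]_d.+1) :
  (forall i, (i <= d)%N -> v i *m M = 0) -> M = 0.
Proof.
move=> M0; apply/row_matrixP=> i; rewrite row0 rowE -[RHS](M0 i) -1?ltnS //.
by congr (_ *m _); apply/rowP=> k; rewrite !mxE eqxx -val_eqE.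
Qed.

Definition companion : 'M['F_2]_d.+1 :=
  \matrix_(i, k) if i == d :> nat then c 0 k else (k == i.+1 :> nat)%:R.

Let companionE : companion = rows (fun i => if i == d then c else v i.+1).
Proof. by apply/matrixP=> i k; rewrite !mxE; case: ifP; rewrite ?mxE. Qed.

(* With [j] the largest index such that [c_j != 0] and [v_0, ..., v_d] the
   standard basis, [E] maps [v_i] to 0 for [i < j], to [v_j] for [j <= i < d],
   and [v_d] to [v_d + c - v_j]; the iterates of [v_0] under [companion - E]
   are [v_0, ..., v_j, v_(j+1) - v_j, ..., v_d - v_(d-1), 0]. *)
Lemma nil_clean_companion : nil_clean_elt companion.
Proof.
(* The iterates [b i] of [v 0], for [i <= d], form a basis triangular in the [v i], so
   [N = companion - E] is nilpotent as soon as [v 0 *m N ^+ d.+1 = 0]. *)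
have nilI (E : 'M['F_2]_d.+1) (b : nat -> 'rV['F_2]_d.+1) :
    idempotent_elt E -> b 0%N = v 0%N ->
    (forall i, exists a, b i.+1 = v i.+1 - a *: v i) ->
    (forall i, (i < d)%N -> b i *m (companion - E) = b i.+1) ->
    b d *m (companion - E) = 0 -> nil_clean_elt companion.
  move=> EE b0 bS bN bd; exists E; split=> //; exists d.+1.
  move: (companion - E) bN bd => N bN bd.
  have bX i : (i <= d)%N -> v 0%N *m N ^+ i = b i.
    elim: i => [|i IHi] lei; first by rewrite expr0 mulmx1.
    by rewrite exprSr -mulmxE mulmxA IHi ?bN // ltnW.
  have v0N : v 0%N *m N ^+ d.+1 = 0 by rewrite exprSr -mulmxE mulmxA bX.
  apply: rows_eq0; elim=> [|i IHi] lei //.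
  have [a bE] := bS i; move/eqP: bE; rewrite -subr_eq opprK => /eqP <-.
  rewrite mulmxDl -scalemxAl IHi ?(ltnW lei) // scaler0 addr0 -bX //.
  by rewrite -mulmxA mulmxE -exprD addnC exprD -mulmxE mulmxA v0N mul0mx.
(* If [c = 0], the companion matrix is itself nilpotent and [E = 0] works. *)
have [j0 cj0|c0] := pickP (fun j => c 0 j != 0); last first.
  have {}c0 : c = 0 by apply/rowP=> k; rewrite mxE; apply/eqP/negbFE/c0.
  apply: (@nilI 0 v) => //.
  - by rewrite /idempotent_elt mulr0.
  - by move=> i; exists 0; rewrite scale0r subr0.
  - move=> i lt_i; rewrite subr0 companionE mul_v_rows ?(ltnW lt_i) //.
    by rewrite ltn_eqF.
  - by rewrite subr0 companionE mul_v_rows // eqxx.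
have [j cj jmax] := @arg_maxnP _ j0 (fun j => c 0 j != 0)
  (fun j => j : nat) cj0.
have lejd : (j <= d)%N by rewrite -ltnS.
(* [w] is [c - v j], supported on indices below [j], so the idempotent [rows f] sends it to 0. *)
pose w : 'rV['F_2]_d.+1 := \row_k if (k < j)%N then c 0 k else 0.
have cE : c = w + v j.
  apply/rowP=> k; rewrite !mxE; case: (ltngtP k j) => [lt|gt|/val_inj->].
  - by rewrite addr0.
  - rewrite addr0; apply/eqP; apply: contraTT gt => ck; rewrite -leqNgt.
    exact: jmax.
  - by rewrite add0r; apply: F2_neq0.
pose f i := if (i < j)%N then 0 else if (i < d)%N then v j else v d + w.
have f_lt i : (i < j)%N -> f i = 0 by rewrite /f => ->.
have f_mid i : (j <= i < d)%N -> f i = v j.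
  by case/andP=> le_ji lt_id; rewrite /f ltnNge le_ji lt_id.
have f_d : f d = v d + w by rewrite /f !ltnNge lejd leqnn.
have wE : w *m rows f = 0.
  rewrite mulmx_sum_row big1 // => k _; rewrite !mxE rowK.
  by case: ifP => [/f_lt->|_]; rewrite ?scaler0 ?scale0r.
have rows_f i : (i <= d)%N -> f i *m rows f = f i.
  move=> lei; have [lt_ij|le_ji] := ltnP i j; first by rewrite f_lt ?mul0mx.
  have [lt_id|le_di] := ltnP i d.
    rewrite f_mid ?le_ji // mul_v_rows // f_mid //.
    by rewrite leqnn (leq_ltn_trans le_ji).
  have -> : i = d by apply/eqP; rewrite eqn_leq lei.
  by rewrite f_d mulmxDl wE addr0 mul_v_rows.
have mulN i : (i < d)%N -> v i *m (companion - rows f) = v i.+1 - f i.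
  move=> lt_id; rewrite mulmxBr companionE !mul_v_rows ?(ltnW lt_id) //.
  by rewrite ltn_eqF.
have mulNd : v d *m (companion - rows f) = v j - v d.
  rewrite mulmxBr companionE !mul_v_rows // eqxx cE f_d.
  by rewrite [v d + w]addrC opprD addrA [w + _]addrC addrK.
pose b i := if (i <= j)%N then v i else v i - v i.-1.
apply: (@nilI (rows f) b) => //.
- apply/row_matrixP=> i; rewrite -mulmxE row_mul !rowK.
  by rewrite rows_f // -ltnS.
- move=> i; rewrite /b; case: ltnP => _.
  + by exists 0; rewrite scale0r subr0.
  + by exists 1; rewrite scale1r.
- move=> i lt_id; rewrite /b; case: (ltngtP i j) => [lt_ij|lt_ji|ij].
  + by rewrite mulN // f_lt // subr0.
  + case: i lt_id lt_ji => // i lt_id le_ji.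
    rewrite mulmxBl !mulN ?(ltnW lt_id) //.
    rewrite !f_mid ?lt_id ?(ltnW lt_id) ?andbT //; last exact: leqW.
    by rewrite opprB addrA subrK.
  + by rewrite mulN // f_mid ?ij ?leqnn // -ij.
- rewrite /b; case: leqP => [le_dj|lt_jd].
    have jd : j = d :> nat by apply/eqP; rewrite eqn_leq lejd.
    by rewrite mulNd jd subrr.
  have d_gt0 : (0 < d)%N by apply: leq_ltn_trans lt_jd.
  have lt_d1d : (d.-1 < d)%N by rewrite prednK.
  have le_jd1 : (j <= d.-1)%N by rewrite -ltnS prednK.
  (* Characteristic 2 enters here: the image is [v j - v d] added to itself. *)
  rewrite mulmxBl mulNd mulN // f_mid ?le_jd1 // prednK //.
  by rewrite opprB F2_addrr.
Qed.
End Companion.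

(** * Arbitrary matrices over F_2 *)

(** The longest independent list [v, v *m A, ..., v *m A ^+ d] spans an invariant subspace on which
    [A] acts as a companion matrix; induction handles the quotient. *)
Lemma nil_clean_F2_mx n (A : 'M['F_2]_n) : nil_clean_elt A.
Proof.
elim/ltn_ind: n A => -[|n] IHn A.
  exists 0; split; first by rewrite /idempotent_elt mulr0.
  by exists 1%N; rewrite expr1; apply: thinmx0.
pose v : 'rV['F_2]_n.+1 := delta_mx 0 0.
pose K k : 'M_(k, n.+1) := \matrix_(i < k) (v *m A ^+ i).
have K1 : row_free (K 1%N).
  apply: inj_row_free => u.
  rewrite mulmx_sum_row big_ord1 rowK expr0 mulmx1 => u0.
  by apply/rowP=> i; have /rowP/(_ 0) := u0; rewrite [i]ord1 !mxE !eqxx mulr1.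
have Kmax k : row_free (K k) -> (k <= n.+1)%N.
  by move/eqP<-; apply: rank_leq_col.
have exK : exists k, row_free (K k) by exists 1%N.
case: (ex_maxnP exK Kmax) => -[|d] Kd dmax.
  by have := dmax _ K1.
have : ~~ row_free (K d.+2) by apply/negP=> /dmax; rewrite ltnn.
rewrite -kermx_eq0 => /rowV0Pn[u /sub_kermxP uK u_neq0].
have KE k (x : 'rV_k) : x *m K k = \sum_(i < k) x 0 i *: (v *m A ^+ i).
  by rewrite mulmx_sum_row; apply: eq_bigr => i _; rewrite rowK.
pose c : 'rV['F_2]_d.+1 := \row_k u 0 (widen_ord (leqnSn _) k).
have {}uK : c *m K d.+1 + u 0 ord_max *: (v *m A ^+ d.+1) = 0.
  rewrite -uK !KE [RHS]big_ord_recr; congr (_ + _).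
  by apply: eq_bigr => k _; rewrite mxE.
(* Otherwise the first [d.+1] iterates would already be dependent. *)
have u1 : u 0 ord_max = 1.
  have [u0|] := eqVneq (u 0 ord_max) 0; last exact: F2_neq0.
  case/eqP: u_neq0; apply/rowP=> k; rewrite mxE.
  have c0 : c = 0.
    by apply: (row_free_inj Kd); rewrite mul0mx -[RHS]uK u0 scale0r addr0.
  case: (unliftP ord_max k) => [i ->|->] //.
  have /rowP/(_ i) := c0; rewrite !mxE => <-; congr (u 0 _).
  by apply/val_inj; rewrite /= /bump leqNgt ltn_ord.
have cK : v *m A ^+ d.+1 = c *m K d.+1.
  by rewrite -[RHS]addr0 -uK u1 scale1r addrA F2_addrr add0r.
apply: (@nil_clean_invariant _ _ _ (K d.+1) (companion c)) => //.
- apply/row_matrixP=> i; rewrite !row_mul rowK -mulmxA mulmxE -exprSr.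
  have [id|id] := eqVneq (i : nat) d.
    rewrite id cK; congr (_ *m _).
    by apply/rowP=> k; rewrite !mxE id eqxx.
  have lt_id : (i.+1 < d.+1)%N by rewrite ltnS ltn_neqAle id -ltnS ltn_ord.
  rewrite -[LHS](rowK (fun i : 'I_d.+1 => v *m A ^+ i) (Ordinal lt_id)) rowE.
  by congr (_ *m _); apply/rowP=> k; rewrite !mxE (negPf id) eqxx -val_eqE.
- exact: nil_clean_companion.
- by move=> D; apply: IHn; rewrite subSS ltnS leq_subr.
Qed.

(** * Idempotent entries and the equivalence *)

(** As [a] commutes with [e], the element [a * a - a] is the product of the commuting factors
    [a - e] and [a + e - 1]. *)
Lemma nil_clean_central (S : pzRingType) (a : S) : (forall s, GRing.comm a s) ->
  nil_clean_elt a -> nilpotent_elt (a * a - a).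
Proof.
move=> aC [e [ee [k ek]]]; exists k.
have -> : a * a - a = (a - e) * (a + e - 1).
  rewrite mulrBr mulr1 mulrBl !mulrDr ee -(aC e) addrKA opprB.
  by rewrite addrA subrK.
rewrite exprMn_comm ?ek ?mul0r //.
apply: commrB (commr1 _); apply: commrD; apply/commr_sym/commrB => //.
exact/commr_sym/aC.
Qed.

(* An idempotent entry [e] splits the matrix along [R = eR x (1 - e)R] into
   two matrices having 1, respectively 0, in that place. *)
Lemma nil_clean_idempotent_mx (R : comPzRingType) n (A : 'M[R]_n) :
  nilpotent_elt (2%:R : R) -> (forall i j, A i j * A i j = A i j) ->
  nil_clean_elt A.
Proof.
move=> nil2 Aid.
(* [s] lists the positions whose entries may differ from 0 and 1; each induction step clears one. *)
suff split (s : seq ('I_n * 'I_n)) (B : 'M[R]_n) :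
    (forall i j, B i j * B i j = B i j) ->
    (forall i j, (i, j) \notin s -> B i j = 0 \/ B i j = 1) -> nil_clean_elt B.
  by apply: (split (enum {: 'I_n * 'I_n})) => // i j; rewrite mem_enum.
elim: s B => [|[p q] s IHs] B Bid B01.
  have -> : B = map_mx intr (\matrix_(i, j) (B i j == 1)%:Z).
    apply/matrixP=> i j; rewrite !mxE; case: eqP => // B1.
    by have [] := B01 i j isT.
  by apply: nil_clean_map_intmx => //; apply: nil_clean_F2_mx.
pose put (x : R) : 'M[R]_n :=
  \matrix_(i, j) if (i, j) == (p, q) then x else B i j.
have put_nc x : x = 0 \/ x = 1 -> nil_clean_elt (put x).
  move=> x01; apply: IHs => i j; rewrite mxE; case: ifPn => // ne_pq.
    by case: x01 => ->; rewrite ?mulr0 ?mulr1.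
  by move=> js; apply: B01; rewrite inE negb_or ne_pq.
pose e := B p q; have ee : e * e = e by apply: Bid.
have -> : B = e%:M * put 1 + (1 - e%:M) * put 0.
  rewrite -(raddfB (@scalar_mx R n) 1 e) -!mulmxE !mul_scalar_mx.
  apply/matrixP=> i j; rewrite !mxE; case: eqP => [[-> ->]|_].
    by rewrite mulr1 mulr0 addr0.
  by rewrite -mulrDl subrKC mul1r.
apply: nil_clean_glue; [by move=> M; apply: comm_scalar_mx | | |].
- by rewrite -mulmxE -scalar_mxM ee.
- by apply: put_nc; right.
- by apply: put_nc; left.
Qed.

Theorem corollary2p9 (R : comPzRingType) (n : nat) (hn : (0 < n)%N) :
  nil_clean R <-> nil_clean 'M[R]_n.
Proof.
split=> [ncR A | ncM a].
  have nil2 : nilpotent_elt (2%:R : R).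
    have := nil_clean_central (mulrC _) (ncR 2%:R).
    by rewrite -natrM -natrB.
  have /fin_all_exists2[e eid Ae] (i : 'I_n) : exists2 ei : 'I_n -> R,
      forall j, ei j * ei j = ei j & forall j, nilpotent_elt (A i j - ei j).
    pose P j x := nilpotent_elt (A i j - x).
    apply: (@fin_all_exists2 _ _ (fun=> @idempotent_elt R) P) => j.
    by have [x []] := ncR (A i j); exists x.
  have -> : A = \matrix_(i, j) e i j + \matrix_(i, j) (A i j - e i j).
    by apply/matrixP=> i j; rewrite !mxE subrKC.
  apply: nil_clean_addmx => [|i j]; last by rewrite mxE.
  by apply: nil_clean_idempotent_mx => // i j; rewrite mxE.
case: n hn ncM => // n _ ncM.
have aC (M : 'M[R]_n.+1) : GRing.comm a%:M M by apply: comm_scalar_mx.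
have [k] := nil_clean_central aC (ncM a%:M).
(* As the size is positive, entry (0, 0) reads off the power of [a * a - a] from the scalar
   matrix. *)
rewrite -mulmxE -scalar_mxM -raddfB -rmorphXn => /matrixP/(_ 0 0).
rewrite !mxE eqxx mulr1n => ak.
have [|y ye] := @idempotent_lift R a; first by exists k.
(* [a] minus this idempotent is [- (a * a - a) * y], nilpotent as [R] is commutative. *)
exists (a + (a * a - a) * y); split=> //; exists k.
by rewrite opprD addrA subrr add0r exprNn exprMn ak mul0r mulr0.
Qed.
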